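(* Let $m\ge1$ and let $X:\Sigma^n\to\mathbb{R}^{n+m}$ be a complete and non-compact $C$-soliton for the inverse mean curvature flow (IMCF) with respect to $\vec 0\in\mathbb{R}^{n+m}$. Then: (1) if $n=2$ and $C<0$, then $\Sigma^n$ is non-parabolic; (2) if $n\ge 3$ and either $C<0$ or $C>\frac{1}{n-2}$, then $\Sigma^n$ is non-parabolic.
   Context: A complete isometric immersion $X:\Sigma^n\to\mathbb{R}^{n+m}$ of an $n$-dimensional Riemannian manifold is a $C$-soliton for the IMCF with respect to $\vec 0$ ($C\in\mathbb{R}$) if $\vec H$ is nowhere zero and $\dfrac{\vec H}{\|\vec H\|^2}=-C X^\perp$ on $\Sigma$, where $\vec H$ is the mean curvature vector of $X$ (the trace of the second fundamental form, so $\vec H=\Delta^\Sigma X$) and $X^\perp$ is the component of the position vector $X$ normal to $\Sigma$. A complete Riemannian manifold $M$ is parabolic if every continuous subharmonic function $u:M\to\mathbb{R}$ ($\Delta u\ge 0$ when $u\in C^2$) with $\sup_M u<\infty$ is constant; it is non-parabolic if it is not parabolic. *)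

(* Defs.v *)
From HB Require Import structures.
From mathcomp Require Import all_boot all_order all_algebra.
From mathcomp Require Import all_classical all_reals all_analysis.
Set Implicit Arguments.
Unset Strict Implicit.
Unset Printing Implicit Defensive.
Import Order.TTheory GRing.Theory Num.Theory.
Import numFieldNormedType.Exports.
Local Open Scope classical_set_scope.
Local Open Scope ring_scope.

Definition dot (R : realType) (k : nat) (u v : 'rV[R]_k) : R :=
  (u *m v^T) 0 0.

Definition partial (R : realType) (n : nat) (W : normedModType R) (a : 'I_n)
    (f : 'rV[R]_n -> W) (y : 'rV[R]_n) : W :=
  derive f y (delta_mx 0 a).

(* Used for open U only: f is of class C^k at every point of U. The values of
   f outside U are irrelevant. *)
Fixpoint Ck (R : realType) (n : nat) (W : normedModType R) (k : nat)
    (U : set 'rV[R]_n) (f : 'rV[R]_n -> W) : Prop :=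
  (forall y, U y -> {for y, continuous f}) /\
  match k with
  | 0 => True
  | k'.+1 => forall a : 'I_n,
      (forall y, U y -> derivable f y (delta_mx 0 a)) /\ Ck k' U (partial a f)
  end.

Definition smooth (R : realType) (n : nat) (W : normedModType R)
    (U : set 'rV[R]_n) (f : 'rV[R]_n -> W) : Prop :=
  forall k, Ck k U f.

(* Row vectors: row a is the image of the a-th coordinate vector under df_y. *)
Definition jac (R : realType) (n k : nat) (f : 'rV[R]_n -> 'rV[R]_k)
    (y : 'rV[R]_n) : 'M[R]_(n, k) :=
  \matrix_(a < n) partial a f y.

(* Chart i is the homeomorphism [chart i : dom i -> chart i @` dom i] with
   inverse [param i]; both are total functions, meaningless off these sets.
   [chart_at p] selects one chart around p. *)
Record smoothManifold (R : realType) (n : nat) := SmoothManifold {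
  carrier :> topologicalType ;
  manifold_hausdorff : hausdorff_space carrier ;
  manifold_second_countable : @second_countable carrier ;
  chart_index : Type ;
  dom : chart_index -> set carrier ;
  chart : chart_index -> carrier -> 'rV[R]_n ;
  param : chart_index -> 'rV[R]_n -> carrier ;
  chart_at : carrier -> chart_index ;
  mem_chart_at : forall p, dom (chart_at p) p ;
  open_dom : forall i, open (dom i) ;
  open_chart : forall i, open (chart i @` dom i) ;
  chartK : forall i p, dom i p -> param i (chart i p) = p ;
  chart_continuous : forall i p, dom i p -> {for p, continuous (chart i)} ;
  param_continuous : forall i y, (chart i @` dom i) y ->
    {for y, continuous (param i)} ;
  transition_smooth : forall i j,
    smooth (chart i @` (dom i `&` dom j)) (chart j \o param i) }.

(* [metric i y] is the matrix (g_ab) of the metric in chart i at the point of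
   coordinates y; [metric_change] says that these matrices represent one and
   the same (0,2)-tensor. *)
Record riemannianManifold (R : realType) (n : nat) := RiemannianManifold {
  manifold :> smoothManifold R n ;
  metric : chart_index manifold -> 'rV[R]_n -> 'M[R]_n ;
  metric_smooth : forall i (a b : 'I_n),
    smooth (chart i @` dom i) (fun y => metric i y a b : R) ;
  metric_sym : forall i y, (chart i @` dom i) y ->
    (metric i y)^T = metric i y ;
  metric_pos : forall i y, (chart i @` dom i) y ->
    forall v : 'rV[R]_n, v != 0 -> 0 < (v *m metric i y *m v^T) 0 0 ;
  metric_change : forall i j y, (chart i @` (dom i `&` dom j)) y ->
    let tau := chart j \o param i in
    metric i y = jac tau y *m metric j (tau y) *m (jac tau y)^T }.

Section Riemannian.
Variables (R : realType) (n : nat) (M : riemannianManifold R n).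

(* Curves are defined on the whole line, only their restriction to [0, 1]
   matters: a (piecewise) C^1 curve on [0, 1] can be reparametrized, with the
   same length, so as to stop at its end points (and at its corners). *)
Definition C1_curve (gamma : R -> M) : Prop :=
  continuous gamma /\
  forall t (i : chart_index M), dom i (gamma t) ->
    derivable (chart i \o gamma) t 1 /\
    {for t, continuous (derive1 (chart i \o gamma))}.

Definition speed (gamma : R -> M) (t : R) : R :=
  let i := chart_at (gamma t) in
  let v : 'rV[R]_n := derive1 (chart i \o gamma) t in
  Num.sqrt ((v *m metric i (chart i (gamma t)) *m v^T) 0 0).

Definition curve_length (gamma : R -> M) : \bar R :=
  (\int[lebesgue_measure]_(t in `[0%R, 1%R]) (speed gamma t)%:E)%E.

(* The value is +oo when p and q lie in different components. *)
Definition riemannian_dist (p q : M) : \bar R :=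
  ereal_inf [set l | exists gamma : R -> M,
    [/\ C1_curve gamma, gamma 0 = p, gamma 1 = q & l = curve_length gamma]].

Definition complete_manifold : Prop :=
  forall x : nat -> M,
    (forall e : R, 0 < e -> exists N, forall k l, (N <= k)%N -> (N <= l)%N ->
      (riemannian_dist (x k) (x l) < e%:E)%E) ->
    exists p, forall e : R, 0 < e -> exists N, forall k, (N <= k)%N ->
      (riemannian_dist (x k) p < e%:E)%E.

(* Gamma_{ab}^c of the Levi-Civita connection in chart i *)
Definition christoffel (i : chart_index M) (y : 'rV[R]_n) (a b c : 'I_n) : R :=
  2^-1 * \sum_(d < n) invmx (metric i y) c d *
    (partial a (fun z => metric i z b d : R) y
     + partial b (fun z => metric i z a d : R) y
     - partial d (fun z => metric i z a b : R) y).

(* The (a, b) entry of the Hessian of u in chart i *)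
Definition hessian (u : M -> R) (i : chart_index M) (y : 'rV[R]_n)
    (a b : 'I_n) : R :=
  partial a (partial b (u \o param i)) y
  - \sum_(c < n) christoffel i y a b c * partial c (u \o param i) y.

(* The Laplace-Beltrami operator, as the metric trace of the Hessian *)
Definition laplacian (u : M -> R) (p : M) : R :=
  let i := chart_at p in
  let y := chart i p in
  \sum_(a < n) \sum_(b < n) invmx (metric i y) a b * hessian u i y a b.

Definition C2_on (D : set M) (u : M -> R) : Prop :=
  forall i : chart_index M, Ck 2 (chart i @` (dom i `&` D)) (u \o param i).

Definition harmonic_on (D : set M) (h : M -> R) : Prop :=
  C2_on D h /\ forall p, D p -> laplacian h p = 0.

(* A continuous function is subharmonic if it is dominated by every harmonic
   function that dominates it on the boundary of a relatively compact domain.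
   Domains with empty boundary must be excluded: on a compact manifold, D = M
   would rule out every function, even the constant ones. *)
Definition subharmonic (u : M -> R) : Prop :=
  continuous u /\
  forall (D : set M) (h : M -> R),
    open D -> connected D -> compact (closure D) ->
    closure D `\` D !=set0 ->
    {within closure D, continuous h} -> harmonic_on D h ->
    (forall p, (closure D `\` D) p -> u p <= h p) ->
    forall p, D p -> u p <= h p.

Definition parabolic : Prop :=
  forall u : M -> R, subharmonic u -> has_ubound (range u) ->
    exists c : R, forall p, u p = c.

End Riemannian.

(* For J of full row rank: v minus its orthogonal projection onto the row
   space of J; see the two lemmas below. *)
Definition normal_part (R : realType) (n k : nat) (J : 'M[R]_(n, k))
    (v : 'rV[R]_k) : 'rV[R]_k :=
  v - v *m J^T *m invmx (J *m J^T) *m J.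

Lemma normal_part_tangent (R : realType) (n k : nat) (J : 'M[R]_(n, k))
    (v : 'rV[R]_k) : (v - normal_part J v <= J)%MS.
Proof. by rewrite /normal_part opprB addrC subrK submxMl. Qed.

Lemma normal_part_orthogonal (R : realType) (n k : nat) (J : 'M[R]_(n, k))
    (v : 'rV[R]_k) : J *m J^T \in unitmx -> normal_part J v *m J^T = 0.
Proof.
by move=> u; rewrite mulmxBl -(mulmxA _ J) mulmxKV // subrr.
Qed.

Section Immersion.
Variables (R : realType) (n k : nat) (M : riemannianManifold R n).

(* X is an immersion because the metric is positive definite. *)
Definition isometric_immersion (X : M -> 'rV[R]_k) : Prop :=
  forall i : chart_index M,
    smooth (chart i @` dom i) (X \o param i) /\
    forall y, (chart i @` dom i) y -> forall a b : 'I_n,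
      metric i y a b =
      dot (partial a (X \o param i) y) (partial b (X \o param i) y).

Definition normal_at (X : M -> 'rV[R]_k) (p : M) (v : 'rV[R]_k) : 'rV[R]_k :=
  let i := chart_at p in normal_part (jac (X \o param i) (chart i p)) v.

(* The value of the second fundamental form at p on the a-th and b-th
   coordinate vectors of the chart [chart_at p] *)
Definition second_fundamental_form (X : M -> 'rV[R]_k) (p : M) (a b : 'I_n) :
    'rV[R]_k :=
  let i := chart_at p in
  normal_at X p (partial a (partial b (X \o param i)) (chart i p)).

Definition mean_curvature (X : M -> 'rV[R]_k) (p : M) : 'rV[R]_k :=
  let i := chart_at p in
  \sum_(a < n) \sum_(b < n)
    invmx (metric i (chart i p)) a b *: second_fundamental_form X p a b.

(* C-soliton for the inverse mean curvature flow with respect to the origin *)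
Definition imcf_soliton (C : R) (X : M -> 'rV[R]_k) : Prop :=
  [/\ complete_manifold M, isometric_immersion X,
      forall p, mean_curvature X p != 0 &
      forall p,
        (dot (mean_curvature X p) (mean_curvature X p))^-1 *:
          mean_curvature X p = - C *: normal_at X p (X p)].

End Immersion.

(* Main.v *)
(* The soliton equation forces <X, H> = -1/C, so that
   Laplacian(|X|^2) = 2 (n - 1/C), while |grad |X|^2|^2 = 4 |X^T|^2 <= 4 |X|^2.
   When n - 1/C > 2, which holds in both cases, choose s > 0 with
   n - 1/C > 2 (s + 1): then u = - |X|^(-2s) is bounded above and
   Laplacian(u) >= 2 s |X|^(-2s-2) (n - 1/C - 2 (s + 1)) > 0.
   A function of positive Laplacian is subharmonic by the maximum principle and
   cannot be constant, since its Laplacian would be nonpositive at a maximum. *)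
Require Import Defs.
From mathcomp Require Import all_boot all_order all_algebra.
From mathcomp Require Import all_classical all_reals all_analysis.
From mathcomp Require Import ring lra.
Set Implicit Arguments.
Unset Strict Implicit.
Unset Printing Implicit Defensive.
Import Order.TTheory GRing.Theory Num.Theory numFieldNormedType.Exports.
Local Open Scope classical_set_scope.
Local Open Scope ring_scope.

(** * Differential calculus in R^n *)

(** Put N = n - 1/C. Then |X|^2 has Laplacian 2 N and gradient norm at most 2 |X|, as |x|^2 does on
    a Euclidean space of dimension N. There |x|^(-2s) is superharmonic exactly for 0 <= 2 s <= N -
    2, which explains both the threshold N > 2 and the exponent. Powers with negative exponent make
    sense because <X, H> = -1/C is nonzero, so X never vanishes. The obstacle is that smoothness
    means existence and continuity of iterated coordinate derivatives only. Linearity of directional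
    derivatives, Schwarz's theorem and the second derivative test are therefore rebuilt from the
    one-variable mean value theorem along lines. At a maximum the inverse metric must be split into
    squares. The immersion supplies the splitting g^-1 = B B^T, so no matrix has to be diagonalized.
    Strict positivity of the Laplacian keeps the maximum principle elementary: the second derivative
    test at an interior maximum is enough. *)

Lemma is_derive_lineP (R : realType) (V W : normedModType R) (f : V -> W)
    (y v : V) (t : R) (df : W) :
  is_derive t 1 (fun s => f (y + s *: v)) df <->
  is_derive (y + t *: v) v f df.
Proof.
have E : (fun h : R => h^-1 *: (((fun s => f (y + s *: v)) \o shift t) (h *: 1)
          - f (y + t *: v))) =
    (fun h : R => h^-1 *: ((f \o shift (y + t *: v)) (h *: v)
          - f (y + t *: v))).
  apply/funext => h /=; congr (_ *: (f _ - _)).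
  by rewrite [h *: 1]mulr1 scalerDl addrCA.
split; first by move=> [d <-]; split; rewrite /derivable /derive -E.
by move=> [d <-]; split; rewrite /derivable /derive /= E.
Qed.

(** The bounds are on absolute values so that h may have either sign, as in a two-sided difference
    quotient. *)
Lemma MVT_line (R : realType) (V : normedModType R) (f : V -> R) (y v : V)
    (h : R) :
  (forall t, `|t| <= `|h| -> derivable f (y + t *: v) v) ->
  exists2 c, `|c| <= `|h| & f (y + h *: v) - f y = h * 'D_v f (y + c *: v).
Proof.
move=> df; pose g (t : R) := f (y + t *: v).
have dg (t : R) : `|t| <= `|h| -> is_derive t 1 g ('D_v f (y + t *: v)).
  by move=> th; apply/is_derive_lineP/derivableP/df.
have cg (a b : R) : (forall t, t \in `[a, b] -> `|t| <= `|h|) ->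
    {within `[a, b], continuous g}.
  move=> ab; apply: derivable_within_continuous => t tab.
  by apply: ex_derive; exact/dg/ab.
have g0 : g 0 = f y by rewrite /g scale0r addr0.
have [h0|h0] := leP 0 h.
  have hh t : t \in `[0, h] -> `|t| <= `|h|.
    by rewrite in_itv/= => /andP[t0 th]; rewrite !ger0_norm.
  have [|c cab] := @MVT_segment R g (fun t => 'D_v f (y + t *: v)) 0 h h0 _
      (cg _ _ hh).
    by move=> x xh; apply/dg/hh; exact: subset_itv_oo_cc xh.
  by rewrite subr0 g0 mulrC => E; exists c => //; exact: hh.
have hh t : t \in `[h, 0] -> `|t| <= `|h|.
  by rewrite in_itv/= => /andP[t0 th]; rewrite !ler0_norm ?lerN2// ltW.
have [|c cab] := @MVT_segment R g (fun t => 'D_v f (y + t *: v)) h 0 (ltW h0) _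
    (cg _ _ hh).
  by move=> x xh; apply/dg/hh; exact: subset_itv_oo_cc xh.
rewrite sub0r g0 => /(congr1 -%R); rewrite opprB mulrN opprK mulrC => ?.
by exists c => //; exact: hh.
Qed.

Lemma is_derive_dirZ (R : realType) (V W : normedModType R) (f : V -> W)
    (y v : V) (k : R) (df : W) :
  is_derive y v f df -> is_derive y (k *: v) f (k *: df).
Proof.
have [->|k0] := eqVneq k 0; first by rewrite !scale0r => _; exact: is_derive0.
move=> [dfy <-]; suff H : (fun h : R => h^-1 *: ((f \o shift y) (h *: (k *: v))
    - f y)) @ 0^' --> k *: 'D_v f y.
  by split; [apply/cvg_ex; eexists; exact: H|exact: cvg_lim H].
have -> : (fun h : R => h^-1 *: ((f \o shift y) (h *: (k *: v)) - f y)) =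
   (fun h : R => k *: ((h * k)^-1 *: ((f \o shift y) ((h * k) *: v) - f y))).
  apply/funext => h; rewrite !scalerA; congr (_ *: _).
  by rewrite invfM mulrCA divff// mulr1.
apply: cvgZr; move=> A /dfy [r /= r0 rA]; exists (r / `|k|).
  by rewrite /= divr_gt0// normr_gt0.
move=> h /=; rewrite sub0r normrN => hr h0; apply: rA => /=; last first.
  by rewrite mulf_neq0.
by rewrite sub0r normrN normrM -ltr_pdivlMr ?normr_gt0.
Qed.

(** The increment is split at y + h v. The first leg gives the derivative along v; the second equals
    h times D_w f at a point tending to y, by the mean value theorem, and continuity of D_w f at y
    gives its limit. *)
Lemma is_derive_dirD (R : realType) (V : normedModType R) (f : V -> R)
    (y v w : V) (dv : R) :
  is_derive y v f dv -> (\forall z \near y, derivable f z w) ->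
  {for y, continuous (fun z => 'D_w f z)} ->
  is_derive y (v + w) f (dv + 'D_w f y).
Proof.
move=> [dfv <-] dfw cw.
suff H : (fun h : R => h^-1 *: ((f \o shift y) (h *: (v + w))
    - f y)) @ 0^' --> 'D_v f y + 'D_w f y.
  by split; [apply/cvg_ex; eexists; exact: H|exact: cvg_lim H].
have -> : (fun h : R => h^-1 *: ((f \o shift y) (h *: (v + w)) - f y)) =
   (fun h : R => h^-1 *: ((f \o shift y) (h *: v) - f y)) +
   (fun h : R => h^-1 *: (f (y + h *: v + h *: w) - f (y + h *: v))).
  apply/funext => h; rewrite !fctE /= -scalerDr; congr (_ *: _).
  by rewrite scalerDr [_ + _ + y]addrC addrA [h *: v + y]addrC [RHS]addrC subrKA.
apply: cvgD; first exact: dfv.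
apply/cvgrPdist_lt => e e0.
move/cvgrPdist_lt: cw => /(_ e e0) cw.
have [d /= d0 dP] := (nbhs_ballP _ _).1 (filterI dfw cw).
have K0 : 0 < `|v| + `|w| + 1 by rewrite ltr_wpDl// addr_ge0.
(* For h below this radius all points y + h v + c w with |c| <= |h| lie in the ball; the summand 1
   keeps the denominator positive when v = w = 0. *)
exists (d / (`|v| + `|w| + 1)); first by rewrite /= divr_gt0.
move=> h /=; rewrite sub0r normrN ltr_pdivlMr// => hd h0.
have near_d (c : R) : `|c| <= `|h| -> ball y d (y + h *: v + c *: w).
  move=> ch; rewrite -ball_normE /ball_ /= -addrA opprD addNKr normrN.
  rewrite (le_lt_trans _ hd)// (le_trans (ler_normD _ _))// !normrZ.
  rewrite !mulrDr -[leLHS]addr0 lerD// ?mulr1// lerD//.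
  by rewrite ler_wpM2r.
have [c ch ->] : exists2 c, `|c| <= `|h| &
    f (y + h *: v + h *: w) - f (y + h *: v) = h * 'D_w f (y + h *: v + c *: w).
  by apply: MVT_line => t th; have [] := dP _ (near_d t th).
rewrite [_ *: _]mulKf//.
by have [] := dP _ (near_d c ch).
Qed.

Lemma near_eq_continuous (T U : topologicalType) (f g : T -> U) (x : T) :
  (\forall z \near x, f z = g z) -> {for x, continuous f} ->
  {for x, continuous g}.
Proof.
move=> fg cf; rewrite /prop_for /continuous_at -(nbhs_singleton fg).
exact: cvg_trans (near_eq_cvg fg) cf.
Qed.

Lemma CkS (R : realType) (n : nat) (W : normedModType R) (k : nat)
    (U : set 'rV[R]_n) (f : 'rV[R]_n -> W) : Ck k.+1 U f -> Ck k U f.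
Proof.
elim: k f => [|k IH] f [cf df]; first by split.
by split => // a; have [dfa Cfa] := df a; split => //; exact: IH.
Qed.

Lemma eq_Ck (R : realType) (n : nat) (W : normedModType R) (k : nat)
    (U : set 'rV[R]_n) (f g : 'rV[R]_n -> W) : open U ->
  (forall y, U y -> f y = g y) -> Ck k U f -> Ck k U g.
Proof.
move=> oU; have nU y : U y -> \forall z \near y, U z.
  by move=> Uy; apply: open_nbhs_nbhs.
have cE (h h' : 'rV[R]_n -> W) y : (forall y, U y -> h y = h' y) -> U y ->
    {for y, continuous h} -> {for y, continuous h'}.
  move=> hh' Uy; apply: near_eq_continuous.
  by near=> z; apply: hh'; near: z; exact: nU.
elim: k f g => [|k IH] f g fg [cf df];
  (split; [by move=> y Uy; exact: cE fg Uy (cf y Uy)|]) => //.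
move=> a; have [dfa Cfa] := df a; split => [y Uy|].
  apply: near_eq_derivable (dfa y Uy).
  by near=> z; apply: fg; near: z; exact: nU.
apply: (IH _ _ _ Cfa) => y Uy; apply: near_eq_derive.
by near=> z; apply: fg; near: z; exact: nU.
Unshelve. all: by end_near. Qed.

(** The direction v is built up one coordinate at a time by [is_derive_dirD]. *)
Lemma C1_is_derive (R : realType) (n : nat) (U : set 'rV[R]_n)
    (f : 'rV[R]_n -> R) (y v : 'rV[R]_n) :
  open U -> Ck 1 U f -> U y ->
  is_derive y v f (\sum_a v 0 a * partial a f y).
Proof.
move=> oU [cf df] Uy; rewrite [X in is_derive _ X]row_sum_delta.
have nU : \forall z \near y, U z by apply: open_nbhs_nbhs.
elim: (index_enum _) => [|a r IH]; first by rewrite !big_nil; exact: is_derive0.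
(* The new coordinate goes to the right summand, where [is_derive_dirD] wants a continuous
   derivative; the partial sum only needs a derivative at y itself. *)
rewrite !big_cons addrC [X in is_derive _ _ _ X]addrC.
have [dfa [cfa _]] := df a.
have dZ z : U z -> is_derive z (v 0 a *: delta_mx 0 a) f (v 0 a * partial a f z).
  by move=> Uz; apply/is_derive_dirZ/derivableP/dfa.
rewrite -(derive_val (is_derive:=dZ y Uy)).
apply: is_derive_dirD => //.
  near=> z; have Uz : U z by near: z.
  by case: (dZ z Uz).
apply: (@near_eq_continuous _ _ (fun z => v 0 a * partial a f z)).
  near=> z; have Uz : U z by near: z.
  by rewrite (derive_val (is_derive:=dZ z Uz)).
by apply: continuousM; [exact: cst_continuous|exact: cfa].
Unshelve. all: by end_near. Qed.

Lemma is_derive_translate (R : realType) (V W : normedModType R) (f : V -> W)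
    (y u v : V) (df : W) :
  is_derive (y + u) v f df -> is_derive y v (fun z => f (z + u)) df.
Proof.
have E : (fun h : R => h^-1 *: (((fun z => f (z + u)) \o shift y) (h *: v)
          - f (y + u))) =
    (fun h : R => h^-1 *: ((f \o shift (y + u)) (h *: v) - f (y + u))).
  by apply/funext => h /=; rewrite addrA.
by move=> [dfy <-]; split; rewrite /derivable /derive /= E.
Qed.

(** The mean value theorem is applied along v to z |-> f (z + h w) - f z, then along w to [fv]. The
    set A is free so that a caller can ask the intermediate point to be as close to y as it
    likes. *)
Lemma second_difference (R : realType) (V : normedModType R)
    (f fv fvw : V -> R) (y v w : V) (A : set V) :
  (\forall z \near y, A z) -> (\forall z \near y, is_derive z v f (fv z)) ->
  (\forall z \near y, is_derive z w fv (fvw z)) ->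
  \forall h \near 0^', exists2 z, A z &
    f (y + h *: v + h *: w) - f (y + h *: v) - (f (y + h *: w) - f y) =
      h * (h * fvw z).
Proof.
move=> nA dfv dfvw.
have [d /= d0 dP] := (nbhs_ballP _ _).1 (filterI nA (filterI dfv dfvw)).
have K0 : 0 < `|v| + `|w| + 1 by rewrite ltr_wpDl// addr_ge0.
exists (d / (`|v| + `|w| + 1)); first by rewrite /= divr_gt0.
move=> h /=; rewrite sub0r normrN ltr_pdivlMr// => hd h0.
have near_d (s t : R) : `|s| <= `|h| -> `|t| <= `|h| ->
    ball y d (y + s *: v + t *: w).
  move=> sh th; rewrite -ball_normE /ball_ /= -addrA opprD addNKr normrN.
  rewrite (le_lt_trans _ hd)// (le_trans (ler_normD _ _))// !normrZ.
  rewrite !mulrDr -[leLHS]addr0 lerD// ?mulr1// lerD//.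
    by rewrite ler_wpM2r.
  by rewrite ler_wpM2r.
have near_d0 (s : R) : `|s| <= `|h| -> ball y d (y + s *: v).
  by move=> sh; have := near_d s 0 sh; rewrite scale0r addr0 normr0; exact.
have dg (t : R) : `|t| <= `|h| ->
    is_derive (y + t *: v) v (fun z => f (z + h *: w) - f z)
      (fv (y + t *: v + h *: w) - fv (y + t *: v)).
  move=> th; apply: is_deriveB.
    by apply/is_derive_translate; have [_ []] := dP _ (near_d t h th (lexx _)).
  by have [_ []] := dP _ (near_d0 t th).
have [|c ch] := @MVT_line R V (fun z => f (z + h *: w) - f z) y v h.
  by move=> t th; case: (dg t th).
rewrite (derive_val (is_derive:=dg c ch)).
have [|c' c'h ->] := @MVT_line R V fv (y + c *: v) w h.
  by move=> t th; have [_ [_]] := dP _ (near_d c t ch th); case.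
have [Az [_ dz]] := dP _ (near_d c c' ch c'h).
by rewrite (derive_val (is_derive:=dz)) => E; exists (y + c *: v + c' *: w).
Qed.

(* Schwarz's theorem: both mixed derivatives are limits of the same second
   difference quotient. *)
Lemma derive_comm (R : realType) (V : normedModType R)
    (f fv fw fvw fwv : V -> R) (y v w : V) :
  (\forall z \near y, is_derive z v f (fv z)) ->
  (\forall z \near y, is_derive z w f (fw z)) ->
  (\forall z \near y, is_derive z w fv (fvw z)) ->
  (\forall z \near y, is_derive z v fw (fwv z)) ->
  {for y, continuous fvw} -> {for y, continuous fwv} -> fvw y = fwv y.
Proof.
move=> dv dw dvw dwv cF cG.
have FG e : 0 < e -> `|fvw y - fwv y| <= e + e.
  move=> e0.
  move/cvgrPdist_lt: (cF) => /(_ _ e0) nA.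
  move/cvgrPdist_lt: (cG) => /(_ _ e0) nB.
  (* One nonzero h serves both orders of differentiation. The second difference is symmetric in v
     and w, so cancelling h twice gives [fvw z1 = fwv z2], and both values are e-close to those at
     y. *)
  have [h [[[z1 z1A E1] [z2 z2B E2]] h0]] := @filter_ex _ (0 : R)^' _ _
    (filterI (filterI (second_difference nA dv dvw) (second_difference nB dw dwv))
      (nbhs_dnbhs_neq (0 : R))).
  have E : fvw z1 = fwv z2.
    apply: (mulfI h0); apply: (mulfI h0); rewrite -E1 -E2.
    by rewrite [y + h *: v + _]addrAC; ring.
  have -> : fvw y - fwv y = (fvw y - fvw z1) - (fwv y - fwv z2).
    by rewrite E; ring.
  by rewrite (le_trans (ler_normB _ _))// lerD// ltW.
apply/eqP; rewrite -subr_eq0 -normr_le0; apply/ler_addgt0Pl => e e0.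
by rewrite addr0 (splitr e) FG// divr_gt0.
Qed.

Lemma partial_comm (R : realType) (n : nat) (U : set 'rV[R]_n)
    (f : 'rV[R]_n -> R) (y : 'rV[R]_n) (a b : 'I_n) :
  open U -> Ck 2 U f -> U y ->
  partial a (partial b f) y = partial b (partial a f) y.
Proof.
move=> oU [_ df] Uy.
have nU : \forall z \near y, U z by apply: open_nbhs_nbhs.
have [dfa [_ dda]] := df a; have [dfb [_ ddb]] := df b.
have [dab [cab _]] := dda b; have [dba [cba _]] := ddb a.
apply: (derive_comm (f := f) (fv := partial b f) (fw := partial a f)
  (v := delta_mx 0 b) (w := delta_mx 0 a)); [near=> z|near=> z|near=> z|near=> z| |].
- by apply/derivableP/dfb; near: z.
- by apply/derivableP/dfa; near: z.
- by apply/derivableP/dba; near: z.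
- by apply/derivableP/dab; near: z.
- exact: cba.
- exact: cab.
Unshelve. all: by end_near. Qed.

(** Restriction to the line through y along v reduces this to the one-variable chain rule, so f need
    only be differentiable along v. *)
Lemma is_derive_compose (R : realType) (V : normedModType R) (phi : R -> R)
    (f : V -> R) (y v : V) (dphi df : R) :
  is_derive (f y) 1 phi dphi -> is_derive y v f df ->
  is_derive y v (phi \o f) (dphi * df).
Proof.
have y0 : y = y + 0 *: v by rewrite scale0r addr0.
rewrite {2 3}y0 => dp /is_derive_lineP df'; apply/is_derive_lineP.
by apply: (is_derive1_comp (f := phi)); rewrite -?y0.
Qed.

(** * Closure properties of the classes C^k *)

Lemma Ck_cst (R : realType) (n : nat) (W : normedModType R) (k : nat)
    (U : set 'rV[R]_n) (c : W) : Ck k U (fun=> c).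
Proof.
elim: k c => [|k IH] c; (split; [by move=> y _; exact: cst_continuous|]) => //.
move=> a; split; first by move=> y _; exact: derivable_cst.
suff -> : partial a (fun=> c) = (fun=> 0) :> ('rV[R]_n -> W) by exact: IH.
by apply/funext => y; exact: derive_cst.
Qed.

Lemma CkD (R : realType) (n : nat) (k : nat) (U : set 'rV[R]_n)
    (f g : 'rV[R]_n -> R) : open U ->
  Ck k U f -> Ck k U g -> Ck k U (fun y => f y + g y).
Proof.
move=> oU; elim: k f g => [|k IH] f g [cf df] [cg dg];
  (split; [by move=> y Uy; apply: continuousD; [exact: cf|exact: cg]|]) => //.
move=> a; have [dfa Cfa] := df a; have [dga Cga] := dg a.
split => [y Uy|]; first by apply: derivableD; [exact: dfa|exact: dga].
apply: (eq_Ck oU _ (IH _ _ Cfa Cga)) => y Uy.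
by rewrite /partial -deriveD//; [exact: dfa|exact: dga].
Qed.

Lemma CkM (R : realType) (n : nat) (k : nat) (U : set 'rV[R]_n)
    (f g : 'rV[R]_n -> R) : open U ->
  Ck k U f -> Ck k U g -> Ck k U (fun y => f y * g y).
Proof.
move=> oU; elim: k f g => [|k IH] f g Cf Cg;
  have [[cf df] [cg dg]] := (Cf, Cg);
  (split; [by move=> y Uy; apply: continuousM; [exact: cf|exact: cg]|]) => //.
move=> a; have [dfa Cfa] := df a; have [dga Cga] := dg a.
split => [y Uy|]; first by apply: derivableM; [exact: dfa|exact: dga].
apply: (eq_Ck oU _ (CkD oU (IH _ _ (CkS Cf) Cga) (IH _ _ (CkS Cg) Cfa))) => y Uy.
by rewrite /partial deriveM//; [exact: dfa|exact: dga].
Qed.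

Lemma Ck_sum (R : realType) (n : nat) (k : nat) (U : set 'rV[R]_n) (I : Type)
    (r : seq I) (f : I -> 'rV[R]_n -> R) : open U ->
  (forall i, Ck k U (f i)) -> Ck k U (fun y => \sum_(i <- r) f i y).
Proof.
move=> oU Cf; elim: r => [|i r IH].
  by apply: (eq_Ck oU _ (Ck_cst k U 0)) => y _; rewrite big_nil.
by apply: (eq_Ck oU _ (CkD oU (Cf i) IH)) => y _; rewrite big_cons.
Qed.

Lemma Ck_powR (R : realType) (n : nat) (k : nat) (U : set 'rV[R]_n)
    (f : 'rV[R]_n -> R) (r : R) : open U -> (forall y, U y -> 0 < f y) ->
  Ck k U f -> Ck k U (fun y => f y `^ r).
Proof.
move=> oU f0; have cp s y : {for y, continuous f} -> U y ->
    {for y, continuous (fun y => f y `^ s)}.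
  move=> cf Uy; apply: (continuous_comp (f := f) (g := fun t => t `^ s)) => //.
  apply/differentiable_continuous/derivable1_diffP.
  by case: (is_derive1_powR s (f0 y Uy)).
(* The exponent is generalized because differentiating lowers it from r to r - 1. *)
elim: k r f f0 cp => [|k IH] r f f0 cp Cf; have [cf df] := Cf;
  (split; [by move=> y Uy; apply: cp => //; exact: cf|]) => //.
move=> a; have [dfa Cfa] := df a.
have dp y : U y -> is_derive y (delta_mx 0 a) (fun y => f y `^ r)
    (r * f y `^ (r - 1) * partial a f y).
  move=> Uy; apply: (is_derive_compose (phi := fun t => t `^ r)).
    exact/is_derive1_powR/f0.
  exact/derivableP/dfa.
split => [y Uy|]; first by case: (dp y Uy).
have Cr := CkM oU (Ck_cst k U r) (IH (r - 1) f f0 cp (CkS Cf)).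
apply: (eq_Ck oU _ (CkM oU Cr Cfa)).
by move=> y Uy; rewrite [RHS](derive_val (is_derive := dp y Uy)).
Qed.

Lemma partial_coord (R : realType) (n k : nat)
    (Y : 'rV[R]_n -> 'rV[R]_k) (y : 'rV[R]_n) (a : 'I_n) (j : 'I_k) :
  derivable Y y (delta_mx 0 a) ->
  partial a (fun z => Y z 0 j) y = partial a Y y 0 j.
Proof. by move=> dY; rewrite /partial (derive_mx dY) mxE. Qed.

Lemma Ck_coord (R : realType) (n k l : nat) (U : set 'rV[R]_n)
    (Y : 'rV[R]_n -> 'rV[R]_l) (j : 'I_l) :
  open U -> Ck k U Y -> Ck k U (fun y => Y y 0 j).
Proof.
move=> oU; elim: k Y => [|k IH] Y [cY dY];
  (split; [move=> y Uy; apply: (continuous_comp (f := Y)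
    (g := fun v : 'rV_l => v 0 j) (cY y Uy)); exact: coord_continuous|]) => //.
move=> a; have [dYa CYa] := dY a.
split => [y Uy|]; first exact: (derivable_mxP _ _ _).1 (dYa y Uy) 0 j.
apply: (eq_Ck oU _ (IH _ CYa)) => y Uy.
by rewrite partial_coord//; exact: dYa.
Qed.

Lemma dotE (R : realType) (k : nat) (u v : 'rV[R]_k) :
  dot u v = \sum_j u 0 j * v 0 j.
Proof. by rewrite /dot mxE; apply: eq_bigr => j _; rewrite mxE. Qed.

Lemma Ck_dot (R : realType) (n k l : nat) (U : set 'rV[R]_n)
    (Y Z : 'rV[R]_n -> 'rV[R]_l) : open U ->
  Ck k U Y -> Ck k U Z -> Ck k U (fun y => dot (Y y) (Z y)).
Proof.
move=> oU CY CZ.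
apply: (eq_Ck oU _ (Ck_sum _ oU (fun j => CkM oU (Ck_coord j oU CY)
  (Ck_coord j oU CZ)))) => y _.
by rewrite dotE.
Qed.

Lemma partial_dot (R : realType) (n k : nat) (Y Z : 'rV[R]_n -> 'rV[R]_k)
    (y : 'rV[R]_n) (a : 'I_n) :
  derivable Y y (delta_mx 0 a) -> derivable Z y (delta_mx 0 a) ->
  partial a (fun y => dot (Y y) (Z y)) y =
  dot (partial a Y y) (Z y) + dot (Y y) (partial a Z y).
Proof.
move=> dY dZ.
have -> : (fun y => dot (Y y) (Z y)) =
    \sum_(j < k) ((fun y => Y y 0 j) * (fun y => Z y 0 j)).
  by apply/funext => z; rewrite dotE fct_sumE.
have dc (X : 'rV[R]_n -> 'rV[R]_k) j : derivable X y (delta_mx 0 a) ->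
    derivable (fun y => X y 0 j) y (delta_mx 0 a).
  by move=> dX; exact: (derivable_mxP _ _ _).1 dX 0 j.
rewrite /partial derive_sum; last by move=> j; apply: derivableM; exact: dc.
rewrite !dotE -big_split; apply: eq_bigr => j _ /=.
rewrite deriveM; [|exact: dc|exact: dc].
rewrite -!partial_coord// [RHS]addrC; congr (_ + _).
by rewrite [RHS]mulrC.
Qed.

(** * Derivative tests at a maximum *)

Lemma local_max_derive (R : realType) (n : nat) (U : set 'rV[R]_n)
    (w : 'rV[R]_n -> R) (y v : 'rV[R]_n) : open U -> Ck 1 U w -> U y ->
  (forall z, U z -> w z <= w y) -> 'D_v w y = 0.
Proof.
move=> oU Cw Uy wmax.
have [d /= d0 dU] := (nbhs_ballP _ _).1 (open_nbhs_nbhs (conj oU Uy)).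
have K0 : 0 < `|v| + 1 by rewrite ltr_wpDl.
pose e := d / (`|v| + 1); have e0 : 0 < e by rewrite divr_gt0.
have Ut t : t \in `](- e), e[ -> U (y + t *: v).
  rewrite in_itv/= -ltr_norml ltr_pdivlMr// => te; apply: dU.
  rewrite -ball_normE /ball_ /= opprD addNKr normrN normrZ.
  by rewrite (le_lt_trans _ te)// mulrDr mulr1 lerDl.
have dw t : t \in `](- e), e[ -> is_derive t 1 (fun s => w (y + s *: v))
    (\sum_a v 0 a * partial a w (y + t *: v)).
  by move=> te; apply/is_derive_lineP; exact: C1_is_derive (Ut t te).
have e0e : 0 \in `](- e), e[ by rewrite in_itv/= oppr_lt0 e0.
have [_ ] : is_derive (y + 0 *: v) v w 0; last by rewrite scale0r addr0.
apply/is_derive_lineP; apply: (@derive1_at_max R _ (- e) e) => //.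
- by rewrite ge0_cp// ltW.
- by move=> t te; case: (dw t te).
- by move=> t te; rewrite scale0r addr0; exact/wmax/Ut.
Qed.

(** If the second derivative S along v were positive, then G = D_v w, which vanishes at y, would be
    positive at y + t v for small t > 0, and w would increase along that ray. *)
Lemma local_max_partial2 (R : realType) (n : nat) (U : set 'rV[R]_n)
    (w : 'rV[R]_n -> R) (y v : 'rV[R]_n) : open U -> Ck 2 U w -> U y ->
  (forall z, U z -> w z <= w y) ->
  \sum_a \sum_b v 0 a * v 0 b * partial a (partial b w) y <= 0.
Proof.
move=> oU Cw Uy wmax; rewrite leNgt; apply/negP.
set S := \sum_a _ => S0.
pose G z := \sum_b v 0 b * partial b w z.
have dw z : U z -> is_derive z v w (G z).
  by move=> Uz; apply: C1_is_derive (CkS Cw) Uz.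
have CG : Ck 1 U G.
  apply: Ck_sum => // b; apply: (CkM oU (Ck_cst 1 U (v 0 b))).
  by have [_ /(_ b)[]] := Cw.
have dG : is_derive y v G S.
  suff -> : S = \sum_a v 0 a * partial a G y by exact: C1_is_derive v oU CG Uy.
  apply: eq_bigr => a _.
  have dbw b : derivable (partial b w) y (delta_mx 0 a).
    by have [_ /(_ b)[_ [_ /(_ a)[dd _]]]] := Cw; exact: dd.
  have -> : G = \sum_b ((fun=> v 0 b) * partial b w).
    by apply/funext => z; rewrite fct_sumE.
  rewrite /partial derive_sum.
    rewrite mulr_sumr; apply: eq_bigr => b _.
    rewrite deriveM; [|exact: derivable_cst|exact: dbw].
    by rewrite derive_cst scaler0 addr0 -mulrA.
  by move=> b; apply: derivableM; [exact: derivable_cst|exact: dbw].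
have G0 : G y = 0.
  by rewrite -(derive_val (is_derive := dw y Uy)) (local_max_derive _ oU (CkS Cw)).
have [r /= r0 Gpos] : \forall h \near 0^', 0 < h^-1 *: (G (h *: v + y) - G y).
  have [dGy GS] := dG; move: dGy; rewrite /derivable => dGy.
  have : h^-1 *: (G (h *: v + y) - G y) @[h --> 0^'] --> S by rewrite -GS.
  by move/cvgr_gt; exact.
have [d /= d0 dU] := (nbhs_ballP _ _).1 (open_nbhs_nbhs (conj oU Uy)).
have K0 : 0 < `|v| + 1 by rewrite ltr_wpDl.
(* Half the minimum is strictly below both radii: the segment stays in U and the difference
   quotients of G on it are positive. *)
pose e := Num.min (d / (`|v| + 1)) r / 2.
have m0 : 0 < Num.min (d / (`|v| + 1)) r by rewrite lt_min r0 divr_gt0.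
have e0 : 0 < e by rewrite divr_gt0.
have e_lt : e < Num.min (d / (`|v| + 1)) r by rewrite ltr_pdivrMr// mulr2n; lra.
have [ed er] : e < d / (`|v| + 1) /\ e < r.
  by move: e_lt; rewrite lt_min => /andP.
clearbody e G S.
have Ut t : t \in `[0, e] -> U (y + t *: v).
  rewrite in_itv/= => /andP[t0 te]; apply: dU.
  rewrite -ball_normE /ball_ /= opprD addNKr normrN normrZ ger0_norm//.
  move: (le_lt_trans te ed); rewrite ltr_pdivlMr//; apply: le_lt_trans.
  by rewrite mulrDr mulr1 lerDl.
pose g (s : R) : R := w (y + s *: v); pose g' (s : R) : R := G (y + s *: v).
have dg t : t \in `[0, e] -> is_derive t 1 g (g' t).
  by move=> te; apply/is_derive_lineP/dw/Ut.
have dg' t : t \in `]0, e[ -> is_derive t 1 g (g' t).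
  by move=> te; apply: dg; exact: subset_itv_oo_cc te.
have cg : {within `[0, e], continuous g}.
  by apply: derivable_within_continuous => t te; case: (dg t te).
have [c cI E] := @MVT R g g' 0 e e0 dg' cg.
move: cI E; rewrite in_itv/= /g scale0r addr0 subr0 => /andP[c0 ce] E.
have : w (y + e *: v) - w y <= 0.
  by rewrite subr_le0; apply/wmax/Ut; rewrite in_itv/= lexx ltW.
rewrite E leNgt mulr_gt0//.
have := Gpos c; rewrite /= sub0r normrN gtr0_norm// (lt_trans ce er) G0 subr0.
by move=> /(_ isT (lt0r_neq0 c0)); rewrite [_ *: _]/(_ * _) pmulr_rgt0
  ?invr_gt0// addrC.
Qed.

(** * Isometric immersions *)

Lemma dotC (R : realType) (k : nat) (u v : 'rV[R]_k) : dot u v = dot v u.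
Proof. by rewrite !dotE; apply: eq_bigr => j _; rewrite mulrC. Qed.

Lemma dotDr (R : realType) (k : nat) (u v w : 'rV[R]_k) :
  dot u (v + w) = dot u v + dot u w.
Proof. by rewrite /dot linearD/= mulmxDr mxE. Qed.

Lemma dotZr (R : realType) (k : nat) (u v : 'rV[R]_k) (c : R) :
  dot u (c *: v) = c * dot u v.
Proof. by rewrite /dot linearZ/= -scalemxAr mxE. Qed.

Lemma dot0r (R : realType) (k : nat) (u : 'rV[R]_k) : dot u 0 = 0.
Proof. by rewrite /dot trmx0 mulmx0 mxE. Qed.

Lemma dotNr (R : realType) (k : nat) (u v : 'rV[R]_k) :
  dot u (- v) = - dot u v.
Proof. by rewrite -scaleN1r dotZr mulN1r. Qed.

Lemma dot_sumr (R : realType) (k : nat) (u : 'rV[R]_k) (I : Type) (r : seq I)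
    (v : I -> 'rV[R]_k) : dot u (\sum_(i <- r) v i) = \sum_(i <- r) dot u (v i).
Proof. by apply: (big_morph (dot u)) => [x y|]; rewrite ?dotDr ?dot0r. Qed.

Lemma dot_ge0 (R : realType) (k : nat) (u : 'rV[R]_k) : 0 <= dot u u.
Proof. by rewrite dotE sumr_ge0// => j _; rewrite -expr2 sqr_ge0. Qed.

Lemma dot_eq0 (R : realType) (k : nat) (u : 'rV[R]_k) :
  (dot u u == 0) = (u == 0).
Proof.
apply/eqP/eqP => [|->]; last exact: dot0r.
rewrite dotE => /psumr_eq0P u0; apply/rowP => j; rewrite mxE.
by apply/eqP; rewrite -sqrf_eq0 expr2 u0// => i _; rewrite -expr2 sqr_ge0.
Qed.

(** The left side is |t|^2 for the tangential projection t of v. Since <v, t> = |t|^2, the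
    difference of the two sides is |v - t|^2. *)
Lemma tangent_normsq_le (R : realType) (n k : nat) (J : 'M[R]_(n, k))
    (v : 'rV[R]_k) : J *m J^T \in unitmx ->
  (v *m J^T *m invmx (J *m J^T) *m (v *m J^T)^T) 0 0 <= dot v v.
Proof.
set g := J *m J^T => gu.
have gT : g^T = g by rewrite /g trmx_mul trmxK.
have giT : (invmx g)^T = invmx g by rewrite trmx_inv gT.
set t := v *m J^T *m invmx g *m J.
have tt : t *m t^T = v *m J^T *m invmx g *m (v *m J^T)^T.
  by rewrite /t !trmx_mul giT trmxK !mulmxA -[_ *m J *m J^T]mulmxA -/g mulmxKV.
have vt : v *m t^T = v *m J^T *m invmx g *m (v *m J^T)^T.
  by rewrite /t !trmx_mul giT trmxK -!mulmxA.
rewrite -subr_ge0; have := dot_ge0 (v - t).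
congr (_ <= _); rewrite -tt /dot linearB/= mulmxBr !mulmxBl vt -[t *m v^T]trmxK.
rewrite [(t *m v^T)^T]trmx_mul trmxK vt -tt [(t *m t^T)^T]trmx_mul trmxK.
by rewrite subrr subr0 !mxE.
Qed.

(** * Charts, the induced metric and Gauss's formula *)

Lemma open_chart_image (R : realType) (n : nat) (M : smoothManifold R n)
    (i : chart_index M) (D : set M) :
  open D -> open (chart i @` (dom i `&` D)).
Proof.
move=> oD.
have -> : chart i @` (dom i `&` D) = chart i @` dom i `&` param i @^-1` D.
  apply/seteqP; split => [_ [p [ip Dp] <-]|_ [[p ip <-]]] /=.
    by split; [exists p|rewrite /= chartK].
  by rewrite chartK// => Dp; exists p.
rewrite openE => y [iy Dy]; apply: filterI.
  by apply: open_nbhs_nbhs; split; [exact: open_chart|].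
by apply: (param_continuous iy); apply: open_nbhs_nbhs.
Qed.

Lemma mem_coord (R : realType) (n : nat) (M : smoothManifold R n) (p : M) :
  (chart (chart_at p) @` dom (chart_at p)) (chart (chart_at p) p).
Proof. by exists p => //; exact: mem_chart_at. Qed.

Lemma metric_unit (R : realType) (n : nat) (M : riemannianManifold R n)
    (i : chart_index M) (y : 'rV[R]_n) :
  (chart i @` dom i) y -> metric i y \in unitmx.
Proof.
move=> iy; rewrite -row_free_unit -kermx_eq0; apply/rowV0P => v /sub_kermxP vg.
apply/eqP/negP => /negP v0; have := metric_pos iy v0.
by rewrite vg mul0mx mxE ltxx.
Qed.

Lemma metric_inv_sym (R : realType) (n : nat) (M : riemannianManifold R n)
    (i : chart_index M) (y : 'rV[R]_n) (a b : 'I_n) : (chart i @` dom i) y ->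
  invmx (metric i y) a b = invmx (metric i y) b a.
Proof. by move=> iy; rewrite -[in LHS](Defs.metric_sym iy) -trmx_inv mxE. Qed.

(** This identifies the Gram matrix inverted in [normal_part] with the metric inverted in
    [christoffel] and [laplacian]. *)
Lemma metric_jac (R : realType) (n k : nat) (M : riemannianManifold R n)
    (X : M -> 'rV[R]_k) (i : chart_index M) (y : 'rV[R]_n) :
  isometric_immersion X -> (chart i @` dom i) y ->
  metric i y = jac (X \o param i) y *m (jac (X \o param i) y)^T.
Proof.
move=> immX iy; have [_ gE] := immX i; apply/matrixP => a b.
by rewrite gE// dotE mxE; apply: eq_bigr => j _; rewrite !mxE.
Qed.

Lemma near_chart (R : realType) (n : nat) (M : smoothManifold R n)
    (i : chart_index M) (y : 'rV[R]_n) : (chart i @` dom i) y ->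
  \forall z \near y, (chart i @` dom i) z.
Proof. by move=> iy; apply: open_nbhs_nbhs; split => //; exact: open_chart. Qed.

Lemma partial_metric (R : realType) (n k : nat) (M : riemannianManifold R n)
    (X : M -> 'rV[R]_k) (i : chart_index M) (y : 'rV[R]_n) (a b c : 'I_n) :
  isometric_immersion X -> (chart i @` dom i) y ->
  let Y := X \o param i in
  partial a (fun z => metric i z b c : R) y =
  dot (partial a (partial b Y) y) (partial c Y y) +
  dot (partial b Y y) (partial a (partial c Y) y).
Proof.
move=> immX iy Y; have [sY gE] := immX i.
have dd e : derivable (partial e Y) y (delta_mx 0 a).
  by have [_ /(_ e)[_ [_ /(_ a)[dd _]]]] := sY 2; exact: dd.
rewrite -partial_dot//; apply: near_eq_derive.
by apply: filterS (near_chart iy) => z iz; exact: gE.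
Qed.

Lemma partial_comm_row (R : realType) (n k : nat) (U : set 'rV[R]_n)
    (Y : 'rV[R]_n -> 'rV[R]_k) (y : 'rV[R]_n) (a b : 'I_n) :
  open U -> Ck 2 U Y -> U y ->
  partial a (partial b Y) y = partial b (partial a Y) y.
Proof.
move=> oU CY Uy; apply/rowP => j.
have nU : \forall z \near y, U z by apply: open_nbhs_nbhs.
have coordE c d : partial c (partial d Y) y 0 j =
    partial c (partial d (fun z => Y z 0 j)) y.
  have [_ /(_ d)[dYd [_ /(_ c)[dYcd _]]]] := CY.
  rewrite -partial_coord; last exact: dYcd.
  apply: near_eq_derive; apply: filterS nU => z Uz.
  by rewrite partial_coord//; exact: dYd.
have E := partial_comm a b oU (Ck_coord j oU CY) Uy.
exact: (etrans (coordE a b) (etrans E (esym (coordE b a)))).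
Qed.

(* Koszul's formula, with [metric i z b c = dot (partial b Y z) (partial c Y z)] *)
Lemma christoffel_immersion (R : realType) (n k : nat)
    (M : riemannianManifold R n) (X : M -> 'rV[R]_k) (i : chart_index M)
    (y : 'rV[R]_n) (a b c : 'I_n) :
  isometric_immersion X -> (chart i @` dom i) y ->
  let Y := X \o param i in
  christoffel i y a b c = \sum_d invmx (metric i y) c d *
    dot (partial a (partial b Y) y) (partial d Y y).
Proof.
move=> immX iy Y; have [sY _] := immX i.
have comm e f := partial_comm_row e f (@open_chart _ _ M i) (sY 2) iy.
(* The six terms come from differentiating the three metric coefficients. Schwarz's theorem
   identifies the primed vectors with the unprimed ones; four terms cancel and two copies of
   [dot p D] remain. *)
have koszul (p q r p' q' r' A B D : 'rV[R]_k) : p' = p -> q' = q -> r' = r ->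
    2^-1 * (dot p D + dot B q + (dot p' D + dot A r) - (dot q' B + dot A r')) =
    dot p D.
  by move=> -> -> ->; rewrite (dotC q); field.
rewrite /christoffel mulr_sumr; apply: eq_bigr => d _.
rewrite mulrCA; congr (_ * _); rewrite !(partial_metric _ _ _ immX iy).
exact: koszul (comm b a) (comm d a) (comm d b).
Qed.

(* Gauss's formula *)
Lemma hessian_immersion (R : realType) (n k : nat)
    (M : riemannianManifold R n) (X : M -> 'rV[R]_k) (i : chart_index M)
    (y : 'rV[R]_n) (a b : 'I_n) :
  isometric_immersion X -> (chart i @` dom i) y ->
  let Y := X \o param i in
  partial a (partial b Y) y - \sum_c christoffel i y a b c *: partial c Y y =
  normal_part (jac Y y) (partial a (partial b Y) y).
Proof.
move=> immX iy Y; rewrite /normal_part; congr (_ - _).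
rewrite -(metric_jac immX iy); set v := partial a _ y.
rewrite [RHS]mulmx_sum_row; apply: eq_bigr => c _; congr (_ *: _).
  rewrite (christoffel_immersion _ _ _ immX iy) mxE; apply: eq_bigr => d _.
  rewrite mulrC (metric_inv_sym _ _ iy) -/Y -/v; congr (_ * _).
  by rewrite dotE mxE; apply: eq_bigr => j _; rewrite !mxE.
by apply/rowP => j; rewrite !mxE.
Qed.

(** * Laplacians of |X|^2 and of its negative powers *)

Lemma partial_NpowR (R : realType) (n : nat) (f : 'rV[R]_n -> R)
    (y : 'rV[R]_n) (s : R) (b : 'I_n) : 0 < f y ->
  derivable f y (delta_mx 0 b) ->
  partial b (fun z => - f z `^ (- s)) y =
    s * f y `^ (- s - 1) * partial b f y.
Proof.
move=> f0 df.
have dp : is_derive (f y) 1 (fun t : R => - t `^ (- s)) (- (- s * f y `^ (- s - 1))).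
  by apply: is_deriveN; exact: is_derive1_powR.
have d := is_derive_compose dp (derivableP df).
by rewrite [LHS](derive_val (is_derive := d)) -mulNr opprK.
Qed.

Lemma partial2_NpowR (R : realType) (n : nat) (U : set 'rV[R]_n)
    (f : 'rV[R]_n -> R) (y : 'rV[R]_n) (s : R) (a b : 'I_n) :
  open U -> Ck 2 U f -> (forall z, U z -> 0 < f z) -> U y ->
  partial a (partial b (fun z => - f z `^ (- s))) y =
    s * f y `^ (- s - 1) * partial a (partial b f) y -
    s * (s + 1) * f y `^ (- s - 2) * (partial a f y * partial b f y).
Proof.
move=> oU [_ df] f0 Uy.
have nU : \forall z \near y, U z by apply: open_nbhs_nbhs.
have [dfa _] := df a; have [dfb [_ /(_ a)[dfab _]]] := df b.
have dp : is_derive (f y) 1 (fun t : R => s * t `^ (- s - 1))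
    (s * ((- s - 1) * f y `^ (- s - 1 - 1))).
  by apply: is_deriveZ; exact/is_derive1_powR/f0.
have d := is_deriveM (is_derive_compose dp (derivableP (dfa y Uy)))
  (derivableP (dfab y Uy)).
transitivity (partial a (fun z => s * f z `^ (- s - 1) * partial b f z) y).
  apply: near_eq_derive; apply: filterS nU => z Uz.
  by apply: partial_NpowR; [exact: f0|exact: dfb].
rewrite [LHS](derive_val (is_derive := d)) /partial /=.
rewrite (_ : - s - 1 - 1 = - s - 2); last by ring.
suff alg (D2 Da Db P Q : R) : s * P * D2 + Db * (s * ((- s - 1) * Q) * Da) =
    s * P * D2 - s * (s + 1) * Q * (Da * Db) by exact: alg.
by ring.
Qed.

(** The squared norm of the gradient, g^ab d_a f d_b f, read in the same chart as [laplacian] so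
    that both combine under one double sum. *)
Definition gradient_normsq (R : realType) (n : nat) (M : riemannianManifold R n)
    (f : M -> R) (p : M) : R :=
  let i := chart_at p in
  let y := chart i p in
  \sum_(a < n) \sum_(b < n) invmx (metric i y) a b *
    (partial a (f \o param i) y * partial b (f \o param i) y).

(** The chain rule Laplacian(phi(f)) = phi'(f) Laplacian(f) + phi''(f) |grad f|^2 for phi(t) =
    -t^(-s); the Christoffel terms involve first derivatives only and so go with phi'. *)
Lemma laplacian_NpowR (R : realType) (n : nat) (M : riemannianManifold R n)
    (f : M -> R) (s : R) (p : M) : C2_on setT f -> (forall q, 0 < f q) ->
  laplacian (fun q => - f q `^ (- s)) p =
    s * f p `^ (- s - 1) * laplacian f p -
    s * (s + 1) * f p `^ (- s - 2) * gradient_normsq f p.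
Proof.
move=> Cf f0; rewrite /laplacian /gradient_normsq.
set i := chart_at p; set y := chart i p.
have ip : dom i p by exact: mem_chart_at.
have Uy : (chart i @` (dom i `&` setT)) y by exists p.
have oU := @open_chart_image _ _ M i _ openT.
have fy : f p = (f \o param i) y by rewrite /= chartK.
rewrite 2!mulr_sumr -sumrB; apply: eq_bigr => a _.
rewrite 2!mulr_sumr -sumrB; apply: eq_bigr => b _.
have hessE : hessian (fun q => - f q `^ (- s)) i y a b =
    s * f p `^ (- s - 1) * hessian f i y a b - s * (s + 1) * f p `^ (- s - 2) *
    (partial a (f \o param i) y * partial b (f \o param i) y).
  have E1 := partial2_NpowR s a b oU (Cf i) (fun z _ => f0 (param i z)) Uy.
  have E2 c : partial c (fun z => - (f \o param i) z `^ (- s)) y =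
      s * f p `^ (- s - 1) * partial c (f \o param i) y.
    rewrite fy; apply: partial_NpowR; first exact: f0.
    by have [_ /(_ c)[dd _]] := Cf i; exact: dd.
  rewrite /hessian [X in X - _ = _]E1 -fy mulrBr mulr_sumr.
  rewrite (eq_bigr (fun c => s * f p `^ (- s - 1) *
    (christoffel i y a b c * partial c (f \o param i) y))); last first.
    by move=> c _; rewrite [X in _ * X = _]E2 mulrCA.
  by rewrite addrAC.
by rewrite hessE; ring.
Qed.

Lemma C2_normsq (R : realType) (n k : nat) (M : riemannianManifold R n)
    (X : M -> 'rV[R]_k) : isometric_immersion X ->
  C2_on setT (fun q => dot (X q) (X q)).
Proof.
move=> immX i; have [sY _] := immX i.
rewrite setIT.
exact: Ck_dot (@open_chart _ _ M i) (sY 2) (sY 2).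
Qed.

Lemma partial_normsq (R : realType) (n k : nat) (Y : 'rV[R]_n -> 'rV[R]_k)
    (y : 'rV[R]_n) (a : 'I_n) : derivable Y y (delta_mx 0 a) ->
  partial a (fun z => dot (Y z) (Y z)) y = 2 * dot (Y y) (partial a Y y).
Proof.
move=> dY; rewrite partial_dot// (dotC (partial a Y y)); ring.
Qed.

Lemma partial2_normsq (R : realType) (n k : nat) (U : set 'rV[R]_n)
    (Y : 'rV[R]_n -> 'rV[R]_k) (y : 'rV[R]_n) (a b : 'I_n) :
  open U -> Ck 2 U Y -> U y ->
  partial a (partial b (fun z => dot (Y z) (Y z))) y =
  2 * (dot (partial a Y y) (partial b Y y) +
       dot (Y y) (partial a (partial b Y) y)).
Proof.
move=> oU CY Uy; have [_ dY] := CY.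
have [dYa _] := dY a; have [dYb [_ /(_ a)[dYab _]]] := dY b.
rewrite -partial_dot; [|exact: dYa|exact: dYab].
have nU : \forall z \near y, U z by apply: open_nbhs_nbhs.
transitivity (partial a (fun z => 2 * dot (Y z) (partial b Y z)) y).
  apply: near_eq_derive; apply: filterS nU => z Uz.
  by apply: partial_normsq; exact: dYb.
have Cd : Ck 1 U (fun z => dot (Y z) (partial b Y z)).
  exact: Ck_dot oU (CkS CY) (dY b).2.
have [_ /(_ a)[dd _]] := Cd.
exact: (deriveMl 2 (dd y Uy)).
Qed.

(** By Gauss's formula the Hessian of |X|^2 is 2 (g + <X, A>), with A the second fundamental form.
    Its trace gives n from g and <X, H> from A. *)
Lemma laplacian_normsq (R : realType) (n k : nat) (M : riemannianManifold R n)
    (X : M -> 'rV[R]_k) (p : M) : isometric_immersion X ->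
  laplacian (fun q => dot (X q) (X q)) p =
  2 * (n%:R + dot (X p) (mean_curvature X p)).
Proof.
move=> immX; rewrite /laplacian /mean_curvature.
have iy := mem_coord p.
set i := chart_at p in iy *; set y := chart i p in iy *.
have Yy : X p = (X \o param i) y by rewrite /= chartK//; exact: mem_chart_at.
have [sY gE] := immX i; set Y := X \o param i in Yy sY gE *.
have hessE a b : hessian (fun q => dot (X q) (X q)) i y a b =
    2 * (metric i y a b + dot (X p) (second_fundamental_form X p a b)).
  rewrite /second_fundamental_form /normal_at.
  have <- := hessian_immersion a b immX iy.
  have dY c : derivable Y y (delta_mx 0 c).
    by have [_ /(_ c)[dd _]] := sY 1; exact: dd.
  have E1 := partial2_normsq a b (@open_chart _ _ M i) (sY 2) iy.
  have E2 c : partial c (fun z => dot (Y z) (Y z)) y =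
      2 * dot (Y y) (partial c Y y) by exact: partial_normsq.
  rewrite /hessian [X in X - _ = _]E1 -/Y.
  rewrite (eq_bigr (fun c => 2 * (christoffel i y a b c *
    dot (Y y) (partial c Y y)))); last first.
    by move=> c _; rewrite mulrCA; congr (_ * _); exact: E2.
  rewrite -mulr_sumr -mulrBr gE// Yy; congr (_ * _).
  rewrite -[LHS]addrA; congr (_ + _).
  rewrite dotDr dotNr dot_sumr; congr (_ - _).
  by apply: eq_bigr => c _; rewrite dotZr.
under eq_bigr do under eq_bigr do rewrite hessE mulrCA mulrDr.
have trE : \sum_a \sum_b invmx (metric i y) a b * metric i y a b = n%:R.
  transitivity (\tr (invmx (metric i y) *m metric i y)).
    apply: eq_bigr => a _; rewrite mxE; apply: eq_bigr => b _.
    by congr (_ * _); rewrite -[in LHS](Defs.metric_sym iy) mxE.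
  by rewrite mulVmx ?metric_unit// mxtrace1.
rewrite dot_sumr -trE -big_split mulr_sumr; apply: eq_bigr => a _ /=.
rewrite dot_sumr -big_split mulr_sumr; apply: eq_bigr => b _ /=.
by rewrite dotZr.
Qed.

(** The gradient of |X|^2 is twice the tangential part of X, whose norm [tangent_normsq_le]
    bounds. *)
Lemma gradient_normsq_le (R : realType) (n k : nat) (M : riemannianManifold R n)
    (X : M -> 'rV[R]_k) (p : M) : isometric_immersion X ->
  gradient_normsq (fun q => dot (X q) (X q)) p <= 4 * dot (X p) (X p).
Proof.
move=> immX; rewrite /gradient_normsq.
have iy := mem_coord p.
set i := chart_at p in iy *; set y := chart i p in iy *.
have Yy : X p = (X \o param i) y by rewrite /= chartK//; exact: mem_chart_at.
have gJ := metric_jac immX iy; have [sY _] := immX i.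
set Y := X \o param i in Yy sY gJ *; set J := jac Y y in gJ.
have gu : J *m J^T \in unitmx by rewrite -gJ metric_unit.
apply: le_trans (ler_wpM2l _ (tangent_normsq_le (X p) gu)) => //.
rewrite -gJ le_eqVlt; apply/orP; left; apply/eqP.
have E2 c : partial c (fun z => dot (Y z) (Y z)) y = 2 * (X p *m J^T) 0 c.
  have [_ /(_ c)[dd _]] := sY 1.
  rewrite partial_normsq; last exact: dd.
  by rewrite Yy dotE mxE; congr (_ * _); apply: eq_bigr => j _; rewrite !mxE.
move: (X p *m J^T) E2 => w E2; rewrite mxE exchange_big mulr_sumr.
apply: eq_bigr => b _; rewrite mxE [w^T b 0]mxE mulr_suml mulr_sumr.
apply: eq_bigr => a _.
transitivity (invmx (metric i y) a b * ((2 * w 0 a) * (2 * w 0 b))).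
  by congr (_ * (_ * _)); exact: E2.
by ring.
Qed.

(** Regularity is asked on D only, because the harmonic comparison functions in [subharmonic] are
    regular nowhere else. *)
Lemma laplacianB (R : realType) (n : nat) (M : riemannianManifold R n)
    (D : set M) (f h : M -> R) (p : M) : open D -> D p ->
  C2_on D f -> C2_on D h ->
  laplacian (fun q => f q - h q) p = laplacian f p - laplacian h p.
Proof.
move=> oD Dp Cf Ch; rewrite /laplacian.
set i := chart_at p; set y := chart i p.
have Uy : (chart i @` (dom i `&` D)) y by exists p => //; split => //; exact: mem_chart_at.
have nU : \forall z \near y, (chart i @` (dom i `&` D)) z.
  by apply: open_nbhs_nbhs; split => //; exact: open_chart_image.
have [_ df] := Cf i; have [_ dh] := Ch i.
have E1 c z : (chart i @` (dom i `&` D)) z ->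
    partial c ((fun q => f q - h q) \o param i) z =
    partial c (f \o param i) z - partial c (h \o param i) z.
  move=> Uz; have [dfc _] := df c; have [dhc _] := dh c.
  exact: deriveB (dfc z Uz) (dhc z Uz).
have E2 a b : partial a (partial b ((fun q => f q - h q) \o param i)) y =
    partial a (partial b (f \o param i)) y -
    partial a (partial b (h \o param i)) y.
  have [_ [_ /(_ a)[dfab _]]] := df b; have [_ [_ /(_ a)[dhab _]]] := dh b.
  apply: etrans (deriveB (dfab y Uy) (dhab y Uy)).
  by apply: near_eq_derive; apply: filterS nU => z Uz; exact: E1.
rewrite -sumrB; apply: eq_bigr => a _; rewrite -sumrB; apply: eq_bigr => b _.
rewrite -mulrBr; congr (_ * _); rewrite /hessian.
rewrite [X in X - _ = _]E2.
rewrite (eq_bigr (fun c => christoffel i y a b c * partial c (f \o param i) y -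
  christoffel i y a b c * partial c (h \o param i) y)); last first.
  by move=> c _; rewrite -mulrBr; congr (_ * _); exact: E1.
rewrite sumrB.
suff alg (r1 r2 s1 s2 : R) : r1 - r2 - (s1 - s2) = r1 - s1 - (r2 - s2).
  exact: alg.
by ring.
Qed.

(** * The maximum principle *)

Lemma Ck_subset (R : realType) (n : nat) (W : normedModType R) (k : nat)
    (U V : set 'rV[R]_n) (f : 'rV[R]_n -> W) : U `<=` V -> Ck k V f -> Ck k U f.
Proof.
move=> UV; elim: k f => [|k IH] f [cf df]; (split; [by move=> y /UV; exact: cf|]) => //.
by move=> a; have [dfa Cfa] := df a; split; [move=> y /UV; exact: dfa|exact: IH].
Qed.

Lemma C2_onB (R : realType) (n : nat) (M : riemannianManifold R n)
    (D : set M) (f h : M -> R) : open D -> C2_on D f -> C2_on D h ->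
  C2_on D (fun q => f q - h q).
Proof.
move=> oD Cf Ch i; have oU := open_chart_image (i := i) oD.
have CNh := CkM oU (Ck_cst 2 _ (-1 : R)) (Ch i).
by apply: (eq_Ck oU _ (CkD oU (Cf i) CNh)) => z _; rewrite /= mulN1r.
Qed.

Lemma C2_continuous (R : realType) (n : nat) (M : riemannianManifold R n)
    (f : M -> R) : C2_on setT f -> continuous f.
Proof.
move=> Cf p; pose i := chart_at p; have ip : dom i p by exact: mem_chart_at.
have [cf _] := Cf i.
apply: (@near_eq_continuous _ _ ((f \o param i) \o chart i)).
  apply: filterS (_ : \forall q \near p, dom i q) => [q iq|].
    by rewrite /= chartK.
  by apply: open_nbhs_nbhs; split => //; exact: open_dom.
apply: continuous_comp; first exact: chart_continuous.
by apply: cf; exists p.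
Qed.

(** B B^T is the sum of the squares of the columns of B, so the trace is a sum of values of the
    quadratic form h on these columns. *)
Lemma trace_le0 (R : realType) (n k : nat) (B : 'M[R]_(n, k))
    (h : 'I_n -> 'I_n -> R) :
  (forall v : 'rV[R]_n, \sum_a \sum_b v 0 a * v 0 b * h a b <= 0) ->
  \sum_a \sum_b (B *m B^T) a b * h a b <= 0.
Proof.
move=> h0.
have -> : \sum_a \sum_b (B *m B^T) a b * h a b =
    \sum_j \sum_a \sum_b (col j B)^T 0 a * (col j B)^T 0 b * h a b.
  rewrite [RHS]exchange_big; apply: eq_bigr => a _.
  rewrite [RHS]exchange_big; apply: eq_bigr => b _.
  by rewrite mxE mulr_suml; apply: eq_bigr => j _; rewrite !mxE.
by apply: sumr_le0 => j _; exact: h0.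
Qed.

(* The inverse metric is g^-1 = B B^T with B = g^-1 J, so the Laplacian is a
   sum of second derivatives along the columns of B. *)
Lemma laplacian_max_le0 (R : realType) (n k : nat) (M : riemannianManifold R n)
    (X : M -> 'rV[R]_k) (D : set M) (w : M -> R) (p : M) :
  isometric_immersion X -> open D -> D p -> C2_on D w ->
  (forall q, D q -> w q <= w p) -> laplacian w p <= 0.
Proof.
move=> immX oD Dp Cw wmax; rewrite /laplacian.
have iy := mem_coord p; have ip := mem_chart_at p.
set i := chart_at p in iy ip *; set y := chart i p in iy *.
have Uy : (chart i @` (dom i `&` D)) y by exists p.
have oU := open_chart_image (i := i) oD.
have gJ := metric_jac immX iy; set J := jac _ _ in gJ.
have gu := metric_unit iy.
(* Since g = J J^T, this is g^-1 = g^-1 g g^-1 with the middle factor split. *)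
have giB : invmx (metric i y) =
    (invmx (metric i y) *m J) *m (invmx (metric i y) *m J)^T.
  have giT : (invmx (metric i y))^T = invmx (metric i y).
    by rewrite trmx_inv (Defs.metric_sym iy).
  by rewrite trmx_mul giT !mulmxA -[_ *m J *m J^T]mulmxA -gJ mulVmx// mul1mx.
have wmaxU z : (chart i @` (dom i `&` D)) z ->
    (w \o param i) z <= (w \o param i) y.
  by move=> [q [iq Dq] <-]; rewrite /= !chartK//; exact: wmax.
(* First derivatives vanish at the maximum, so the Christoffel part of the Hessian drops out. *)
have w1 c : partial c (w \o param i) y = 0.
  exact: local_max_derive oU (CkS (Cw i)) Uy wmaxU.
rewrite [X in X <= 0](_ : _ = \sum_a \sum_b invmx (metric i y) a b *
    partial a (partial b (w \o param i)) y); last first.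
  apply: eq_bigr => a _; apply: eq_bigr => b _; congr (_ * _).
  rewrite /hessian big1 ?subr0// => c _.
  by apply/eqP; rewrite mulf_eq0; apply/orP; right; apply/eqP; exact: w1.
rewrite giB; apply: trace_le0 => v.
exact: local_max_partial2 oU (Cw i) Uy wmaxU.
Qed.

(** If u > h somewhere in D, the maximum of u - h over the compact closure is positive, hence
    attained inside D. The Laplacian of u - h is nonpositive there, yet equals that of u. *)
Lemma laplacian_gt0_subharmonic (R : realType) (n k : nat)
    (M : riemannianManifold R n) (X : M -> 'rV[R]_k) (u : M -> R) :
  isometric_immersion X -> C2_on setT u -> (forall p, 0 < laplacian u p) ->
  subharmonic u.
Proof.
move=> immX Cu lu; have cu := C2_continuous Cu.
split => // D h oD _ cD _ ch [Ch lh] uh p Dp.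
rewrite leNgt; apply/negP => hu.
have cw : {within closure D, continuous (fun q => u q - h q)}.
  have cu' : {within closure D, continuous u} by exact: continuous_subspaceT.
  by move=> q; apply: cvgB; [exact: cu'|exact: ch].
have [|q /set_mem Dq qmax] := compact_EVT_max _ cD cw.
  by exists p; exact: subset_closure.
have wq : 0 < u q - h q.
  apply: lt_le_trans (qmax p _); first by rewrite subr_gt0.
  by apply/mem_set; exact: subset_closure.
have Dq' : D q.
  apply: contrapT => nDq; have := uh q (conj Dq nDq).
  by rewrite leNgt -subr_gt0 wq.
have CuD : C2_on D u.
  by move=> i; apply: Ck_subset (Cu i); apply: image_subset => z [].
have : laplacian (fun q => u q - h q) q <= 0.
  apply: (laplacian_max_le0 immX oD Dq' (C2_onB oD CuD Ch)) => z Dz.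
  by apply: qmax; apply/mem_set; exact: subset_closure.
by rewrite (laplacianB oD Dq' CuD Ch) lh// subr0 leNgt lu.
Qed.

(** * Solitons *)

(** The equation makes H a multiple of the normal part of X, hence normal, so pairing with H does
    not see the tangential part of X. The product form avoids dividing by C, whose nonvanishing is a
    consequence. *)
Lemma soliton_dot_mean_curvature (R : realType) (n k : nat)
    (M : riemannianManifold R n) (X : M -> 'rV[R]_k) (C : R) (p : M) :
  imcf_soliton C X -> - C * dot (X p) (mean_curvature X p) = 1.
Proof.
move=> [_ immX /(_ p) H0 /(_ p)]; move: (mean_curvature X p) H0 => H H0.
rewrite /normal_at; set J := jac _ _; set N := normal_part J (X p) => eqH.
have ip := mem_coord p.
have gu : J *m J^T \in unitmx.
  by rewrite -(metric_jac immX ip) metric_unit.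
have h0 : dot H H != 0 by rewrite dot_eq0.
have HJ : H *m J^T = 0.
  rewrite -[H](scalerKV h0) eqH -!scalemxAl normal_part_orthogonal//.
  by rewrite !scaler0.
have -> : dot (X p) H = dot H N.
  rewrite dotC /N /normal_part dotDr dotNr.
  rewrite [X in - X](_ : _ = 0) ?subr0// /dot trmx_mul mulmxA HJ mul0mx mxE.
  by [].
by rewrite -dotZr -eqH dotZr mulVf.
Qed.

Lemma soliton_nonparabolic (R : realType) (n k : nat)
    (M : riemannianManifold R n) (X : M -> 'rV[R]_k) (C : R) :
  imcf_soliton C X -> ~ compact [set: M] -> 2 < n%:R - C^-1 -> ~ parabolic M.
Proof.
move=> solX ncM nC parM; have [_ immX _ _] := solX.
have dotXH p := soliton_dot_mean_curvature p solX.
(* The empty manifold is compact, so noncompactness supplies a point. *)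
have [p0 _] : [set: M] !=set0.
  by apply/set0P/eqP => M0; apply: ncM; rewrite M0; exact: compact0.
have C0 : C != 0.
  apply/eqP => C0; have := dotXH p0; rewrite C0 oppr0 mul0r.
  by move/esym/eqP; rewrite oner_eq0.
pose r q := dot (X q) (X q).
have r0 q : 0 < r q.
  rewrite lt_def dot_ge0 andbT dot_eq0; apply/eqP => X0.
  have := dotXH q; rewrite X0 dotC dot0r mulr0 => /esym/eqP.
  by rewrite oner_eq0.
have Cr : C2_on setT r by exact: C2_normsq.
have lr q : laplacian r q = 2 * (n%:R - C^-1).
  rewrite laplacian_normsq//; congr (_ * (_ + _)).
  by apply: (mulfI C0); rewrite mulrN divff// -(dotXH q); ring.
(* The midpoint of the admissible interval from 0 to (N - 2) / 2, where N = n - 1/C; the margin in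
   [ns] is then N - 2. *)
pose s := (n%:R - C^-1 - 2) / 4.
have s0 : 0 < s by rewrite /s; lra.
have s1 : 0 < s + 1 by rewrite addr_gt0.
have ns : 0 < 2 * (n%:R - C^-1) - 4 * (s + 1) by rewrite /s; lra.
clearbody s.
pose u q := - r q `^ (- s).
have Cu : C2_on setT u.
  move=> i; have oU := open_chart_image (i := i) (@openT M).
  have Cp := Ck_powR (- s) oU (fun z _ => r0 (param i z)) (Cr i).
  have CN := CkM oU (Ck_cst 2 _ (-1 : R)) Cp.
  by apply: (eq_Ck oU _ CN) => z _; rewrite mulN1r.
have lu q : 0 < laplacian u q.
  rewrite laplacian_NpowR// lr.
  have E : r q `^ (- s - 1) = r q `^ (- s - 2) * r q.
    rewrite -[X in _ = _ * X](powRr1 (ltW (r0 q))) -powRD ?(gt_eqF (r0 q)) ?implybT//.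
    by congr (_ `^ _); ring.
  have P0 : 0 < r q `^ (- s - 2) by rewrite powR_gt0.
  (* The lower bound replaces |grad r|^2 by 4 r; writing r^(-s-1) as r^(-s-2) r lets both terms
     share one factor. *)
  apply: (@lt_le_trans _ _ (s * r q `^ (- s - 2) * r q *
      (2 * (n%:R - C^-1) - 4 * (s + 1)))).
    by rewrite !mulr_gt0.
  rewrite E mulrBr [s * (_ * r q)]mulrA lerD2l lerN2.
  rewrite [leRHS](_ : _ = s * (s + 1) * r q `^ (- s - 2) * (4 * r q)); last by ring.
  apply: ler_wpM2l; last exact: gradient_normsq_le.
  by rewrite ltW// !mulr_gt0.
have su := laplacian_gt0_subharmonic immX Cu lu.
have [|c uc] := parM u su.
  by exists 0 => _ [q _ <-]; rewrite oppr_le0 powR_ge0.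
(* A constant function is maximal at every point, so the test applies at [p0] with D the whole
   manifold. *)
have : laplacian u p0 <= 0.
  by apply: (laplacian_max_le0 immX openT _ Cu) => // q _; rewrite !uc.
by rewrite leNgt lu.
Qed.

Unset Implicit Arguments.

Theorem corollary4p2 (R : realType) (n m : nat) (Sigma : riemannianManifold R n)
    (X : Sigma -> 'rV[R]_(n + m)) (C : R) :
  (1 <= m)%N ->
  imcf_soliton C X ->
  ~ compact [set: Sigma] ->
  (n = 2%N -> C < 0 -> ~ parabolic Sigma) /\
  ((3 <= n)%N -> C < 0 \/ 1 / (n%:R - 2%:R) < C -> ~ parabolic Sigma).
Proof.
move=> _ solX ncS; split=> [n2 C0|n3 CC].
  apply: (soliton_nonparabolic solX ncS).
  by rewrite n2 ltrBrDl gtrDr invr_lt0.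
apply: (soliton_nonparabolic solX ncS).
have n3R : (3 : R) <= n%:R by rewrite ler_nat.
case: CC => [C0|].
  by have := C0; rewrite -invr_lt0; lra.
rewrite div1r => CC.
have d0 : 0 < (n%:R - 2%:R : R) by lra.
have C0 : 0 < C by apply: lt_trans CC; rewrite invr_gt0.
(* As C and n - 2 are positive, inverting the hypothesis gives 1/C < n - 2. *)
by move: CC; rewrite invf_plt// => CC; lra.
Qed.
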